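(* Let $k$ be a positive integer and let $G$ be a simple $k$-connected graph of order $n\geq 3$ with minimum degree $\delta=\delta(G)$. Let $s\in\{1,0,-1\}$ and suppose $$\mu_{1}(G)<\frac{n\delta}{n-k+s-1}.$$ Then: (i) if $s=1$, $G$ is Hamiltonian-connected; (ii) if $s=0$, $G$ is Hamiltonian; (iii) if $s=-1$, $G$ is traceable.
   Context: All graphs are simple, undirected and connected. A graph $G$ is $k$-connected if its vertex connectivity satisfies $\kappa(G)\geq k$. The Laplacian matrix is $L(G)=D(G)-A(G)$, where $D(G)$ is the diagonal matrix of vertex degrees and $A(G)$ the adjacency matrix; $\mu_1(G)$ denotes its largest eigenvalue (the Laplacian spectral radius). A graph is Hamiltonian-connected if every two distinct vertices are joined by a Hamiltonian path (a path through all vertices); Hamiltonian if it contains a cycle through all vertices; traceable if it contains a Hamiltonian path. *)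

(* Defs.v *)
From HB Require Import structures.
From mathcomp Require Import all_boot all_order all_algebra.
From mathcomp Require Import reals.

Set Implicit Arguments.
Unset Strict Implicit.
Unset Printing Implicit Defensive.

Import Order.TTheory GRing.Theory Num.Theory.

Record sgraph := SGraph {
  vertex :> finType;
  adj : rel vertex;
  adj_sym : symmetric adj;
  adj_irr : irreflexive adj
}.

Definition deg (G : sgraph) (x : G) : nat := #|[set y | adj x y]|.

(* The default value #|G| exceeds every degree, so it plays no role when G has
   at least one vertex. *)
Definition min_degree (G : sgraph) : nat := \big[minn/#|G|]_(x : G) deg x.

(* The subgraph induced by A is connected; this holds trivially when A has at
   most one element. *)
Definition connected_in (G : sgraph) (A : {set G}) : bool :=
  [forall x in A, forall y in A,
     connect [rel u v | [&& u \in A, v \in A & adj u v]] x y].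

Definition connected_graph (G : sgraph) : bool := connected_in [set: G].

(* kappa(G) is the least number of vertices whose deletion leaves a graph that
   is disconnected or has at most one vertex; hence kappa(K_n) = n - 1.  The
   set S = V(G) is admissible, so the default value #|G| is harmless. *)
Definition vertex_connectivity (G : sgraph) : nat :=
  \big[minn/#|G|]_(S : {set G} | ~~ connected_in (~: S) || (#|~: S| <= 1))
     #|S|.

Definition k_connected (k : nat) (G : sgraph) : bool :=
  k <= vertex_connectivity G.

Definition hamiltonian_path (G : sgraph) (x y : G) : Prop :=
  exists p : seq G,
    [/\ path (@adj G) x p, last x p = y, uniq (x :: p)
      & forall z : G, z \in x :: p].

Definition hamiltonian_connected (G : sgraph) : Prop :=
  forall x y : G, x != y -> hamiltonian_path x y.

(* A cycle of a simple graph has at least three vertices; ucycle alone would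
   also accept [:: x; y] for an edge xy, and the empty sequence. *)
Definition hamiltonian (G : sgraph) : Prop :=
  exists c : seq G,
    [/\ ucycle (@adj G) c, 2 < size c & forall z : G, z \in c].

Definition traceable (G : sgraph) : Prop :=
  exists x y : G, hamiltonian_path x y.

Local Open Scope ring_scope.

Definition adjacency_mx (R : realType) (G : sgraph) : 'M[R]_#|G| :=
  \matrix_(i, j) (adj (enum_val i) (enum_val j))%:R.

Definition degree_mx (R : realType) (G : sgraph) : 'M[R]_#|G| :=
  diag_mx (\row_i (deg (enum_val i))%:R).

Definition laplacian_mx (R : realType) (G : sgraph) : 'M[R]_#|G| :=
  degree_mx R G - adjacency_mx R G.

Definition largest_eigenvalue (R : realType) (n : nat) (A : 'M[R]_n) (a : R)
    : Prop :=
  eigenvalue A a /\ (forall b : R, eigenvalue A b -> b <= a).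

(* The relation is functional, and total for graphs with a vertex because the
   Laplacian is a real symmetric matrix. *)
Definition laplacian_spectral_radius (R : realType) (G : sgraph) (mu : R)
    : Prop :=
  largest_eigenvalue (laplacian_mx R G) mu.

(* Main.v *)
(* The test vector n 1_S - |S| 1 in the Rayleigh quotient of the Laplacian gives
   n delta <= mu1 (n - |S|) for every nonempty independent set S, so the
   hypothesis on mu1 bounds the independence number by k - s.  The conclusions
   are then the three forms of the Chvatal-Erdos theorem.

   For these, take a longest path (with prescribed ends, or closed up to a
   cycle, or with free ends) and a vertex h outside it.  The set N of vertices
   of the path adjacent to the component of h is a vertex cut, so |N| >= k, and
   the successors on the path of the vertices of N form together with h an
   independent set: otherwise a detour through the component of h would give a
   longer path with the same ends.  Closing up to a cycle, the path can be
   rotated so that its last vertex is not in N; with free ends, the last vertex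
   is not in N and the first vertex can be added to the independent set. *)

Require Import Defs.
From mathcomp Require Import all_boot all_order all_algebra.
From mathcomp Require Import reals boolp spectral complex zify ring lra.

Set Implicit Arguments.
Unset Strict Implicit.
Unset Printing Implicit Defensive.

Import Order.TTheory GRing.Theory Num.Theory.

(** * Independent sets, vertex cuts and longest sequences *)

Definition independent (G : sgraph) (S : {set G}) : bool :=
  [forall u in S, forall v in S, ~~ adj u v].

Lemma k_connected_cut (k : nat) (G : sgraph) (S : {set G}) :
  k_connected k G -> ~~ connected_in (~: S) -> k <= #|S|.
Proof.
move=> /leq_trans k_le S_cut; apply: k_le.
by apply: (@bigmin_inf _ _ _ #|G| S _ _ (fun S : {set G} => #|S|));
  rewrite ?S_cut.
Qed.

Lemma connected_path (G : sgraph) (x y : G) : connected_graph G ->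
  exists p : seq G, [/\ path (@adj G) x p, last x p = y & uniq (x :: p)].
Proof.
move=> /forall_inP/(_ x (in_setT x))/forall_inP/(_ y (in_setT y)).
case/connectP=> q path_q ->; case: (shortenP path_q) => p path_p uniq_p _.
exists p; split=> //; apply: sub_path path_p => u v.
by rewrite /= !inE.
Qed.

(** Duplicate-free sequences over [T] have size at most [#|T|], so the attained sizes have a
    maximum; [P] is a [Prop], hence the classical reflection. *)
Lemma exists_longest (T : finType) (P : seq T -> Prop) (c0 : seq T) :
  P c0 -> (forall c, P c -> uniq c) ->
  exists2 c, P c & forall c', P c' -> size c' <= size c.
Proof.
move=> Pc0 P_uniq; pose Q m := `[< exists2 c, P c & size c = m >].
have exQ : exists m, Q m by exists (size c0); apply/asboolP; exists c0.
have Q_le m : Q m -> m <= #|T|.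
  by move=> /asboolP[c /P_uniq/card_uniqP <- <-]; exact: max_card.
case: (ex_maxnP exQ Q_le) => m /asboolP[c Pc <-] c_max.
by exists c => // c' Pc'; apply: c_max; apply/asboolP; exists c'.
Qed.

(** * Components outside a sequence and their attachments *)

Definition outside_adj (G : sgraph) (c : seq G) : rel G :=
  [rel u v | [&& u \notin c, v \notin c & adj u v]].

(* The vertices of c adjacent to the component of G - c that contains h. *)
Definition attachments (G : sgraph) (c : seq G) (h : G) : {set G} :=
  [set u in c | [exists v, connect (outside_adj c) h v && adj u v]].

Lemma outside_adj_sym (G : sgraph) (c : seq G) :
  connect_sym (outside_adj c).
Proof.
apply: sym_connect_sym => u v; rewrite /outside_adj /= adj_sym.
by case: (u \in c); case: (v \in c).
Qed.

Lemma connect_outside (G : sgraph) (c : seq G) (h v : G) :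
  h \notin c -> connect (outside_adj c) h v -> v \notin c.
Proof.
move=> hc /connectP[p].
elim: p h hc => [|u p IHp] h hc /=; first by move=> _ ->.
by case/andP=> /and3P[_ uc _]; exact: IHp.
Qed.

(** Allows a cycle to be rotated without changing its attachments. *)
Lemma eq_attachments (G : sgraph) (c c' : seq G) (h : G) :
  c =i c' -> attachments c h = attachments c' h.
Proof.
move=> eq_c; apply/setP => u; rewrite !inE eq_c; congr (_ && _).
apply: eq_existsb => v; congr (_ && _); apply: eq_connect => a b.
by rewrite /outside_adj /= !eq_c.
Qed.

(** Both attachments have a neighbour in the component of [h], and these neighbours are joined
    inside it. The link [a :: q] is never empty, so inserting it strictly lengthens a path; it need
    not contain [h]. *)
Lemma attachments_link (G : sgraph) (c : seq G) (h u w : G) :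
  h \notin c -> u \in attachments c h -> w \in attachments c h ->
  exists a q, [/\ adj u a, path (@adj G) a q, adj (last a q) w, uniq (a :: q)
                & {in a :: q, forall v, v \notin c}].
Proof.
move=> hc; rewrite !inE => /andP[_ /existsP[a /andP[ha ua]]].
move=> /andP[_ /existsP[b /andP[hb wb]]].
have ac := connect_outside hc ha.
have : connect (outside_adj c) a b.
  by rewrite (connect_trans _ hb) // outside_adj_sym.
case/connectP=> q0 path_q0 b_last; move: wb; rewrite b_last {b_last hb}.
case: (shortenP path_q0) => q path_q uniq_q _ wb.
exists a, q; split=> //; first by apply: sub_path path_q => x y /and3P[].
  by rewrite adj_sym.
by move=> v /(path_connect path_q); exact: connect_outside.
Qed.

(** A walk from [h] that avoids the attachments never enters [c]: the first vertex of [c] on it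
    would be an attachment. Hence the attachments separate [h] from [z]. *)
Lemma attachments_cut (k : nat) (G : sgraph) (c : seq G) (h z : G) :
  k_connected k G -> h \notin c -> z \in c -> z \notin attachments c h ->
  k <= #|attachments c h|.
Proof.
move=> Gk hc zc zN; apply: (k_connected_cut Gk).
apply/negP => /forall_inP/(_ h) /=; rewrite !inE (negPf hc) => /(_ isT).
move/forall_inP/(_ z); rewrite inE => /(_ zN).
set r := [rel u v | _] => h_z.
suff : connect (outside_adj c) h z by move/(connect_outside hc); rewrite zc.
case/connectP: h_z => p; move: (connect0 (outside_adj c) h).
elim: p {2 3 4}h => [|v p IHp] u hu /=; first by move=> _ ->.
case/andP=> /and3P[_ + uv]; rewrite inE => vN; apply: IHp.
apply: (connect_trans hu); apply: connect1.
rewrite /outside_adj /= (connect_outside hc hu) uv andbT.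
apply: contra vN => vc.
by rewrite !inE vc; apply/existsP; exists u; rewrite hu adj_sym.
Qed.

(** * Successors along a path *)

(** The index is taken in [x :: p] but read in [p], which shifts by one. On a duplicate-free path
    the last vertex gets the default, itself. *)
Definition successor (T : eqType) (x : T) (p : seq T) (u : T) : T :=
  nth u p (index u (x :: p)).

Lemma successorE (T : eqType) (x d : T) (A D : seq T) :
  uniq (x :: A ++ d :: D) -> successor x (A ++ d :: D) (last x A) = d.
Proof.
rewrite /successor -cat_cons cat_uniq => /andP[uniq_A _].
by rewrite index_cat mem_last index_last // nth_cat ltnn subnn.
Qed.

Lemma split_successor (T : eqType) (x u : T) (p : seq T) :
  u \in x :: p -> u != last x p ->
  exists A d D, p = A ++ d :: D /\ last x A = u.
Proof.
elim: p x => [|y p IHp] x; first by rewrite mem_seq1 => /= ->.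
rewrite inE => /predU1P[-> _|/IHp IH u_last]; first by exists [::], y, p.
by have [A [d [D [-> <-]]]] := IH u_last; exists (y :: A), d, D.
Qed.

(** Either vertex may come first on the path, hence the disjunction; [b] follows the earlier one and
    [d] the later one. *)
Lemma split_successor2 (T : eqType) (x u w : T) (p : seq T) :
  u \in x :: p -> u != last x p -> w \in x :: p -> w != last x p -> u != w ->
  exists A b B d D, p = A ++ (b :: B) ++ d :: D /\
    (last x A = u /\ last b B = w \/ last x A = w /\ last b B = u).
Proof.
move=> up u_last wp w_last uw.
have [A [d [D [p_eq Au]]]] := split_successor up u_last.
move: wp w_last; rewrite p_eq -cat_cons mem_cat last_cat /=.
case/orP=> [wA|wD] w_last.
  rewrite -Au eq_sym in uw.
  have [A1 [b [B [A_eq A1w]]]] := split_successor wA uw.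
  exists A1, b, B, d, D; split; first by rewrite A_eq -catA.
  by right; rewrite A1w -Au A_eq last_cat.
have [B [d' [D' [D_eq Bw]]]] := split_successor wD w_last.
by exists A, d, B, d', D'; rewrite D_eq; split; last left.
Qed.

(** * Longest paths and their detours *)

Definition is_path (G : sgraph) (x : G) (p : seq G) : bool :=
  path (@adj G) x p && uniq (x :: p).

(** Only paths with the same ends compete, so the notion also covers a longest cycle cut open and a
    longest path with free ends. *)
Definition longest_path (G : sgraph) (x : G) (p : seq G) : Prop :=
  is_path x p /\
  forall q, is_path x q -> last x q = last x p -> size q <= size p.

(** From [last x A] the detour follows [a :: q] to [last b B], runs back to [b] and jumps to [d].
    The reversed segment is a path because [adj] is symmetric. *)
Lemma path_detour (G : sgraph) (x a b d : G) (A B D q : seq G) :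
  path (@adj G) x (A ++ (b :: B) ++ d :: D) ->
  adj (last x A) a -> path (@adj G) a q -> adj (last a q) (last b B) ->
  adj b d -> path (@adj G) x (A ++ (a :: q) ++ rev (b :: B) ++ d :: D).
Proof.
have rev_last : last (last b B) (rev (belast b B)) = b.
  by case: (B) => //= y s; rewrite rev_cons last_rcons.
rewrite lastI rev_rcons -lastI.
rewrite !(cat_path, cat_cons) /= ?(cat_path, cat_cons) /=.
rewrite rev_last rev_path.
rewrite (eq_path (e' := @adj G)) => [|u v]; last exact: adj_sym.
by move=> /and4P[-> /andP[_ ->] _ ->] -> -> -> ->.
Qed.

(** Such a path would be duplicate-free, keep both ends and gain the nonempty link [a :: q]. *)
Lemma longest_path_no_detour (G : sgraph) (x a : G) (p q p' : seq G) :
  longest_path x p -> uniq (a :: q) -> {in a :: q, forall v, v \notin x :: p} ->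
  perm_eq p' ((a :: q) ++ p) -> last x p' = last x p ->
  ~ path (@adj G) x p'.
Proof.
move=> [/andP[_ uniq_p] p_max] uniq_q q_out p'_perm last_p' path_p'.
have p'_perm1 : perm_eq (x :: p') ((a :: q) ++ x :: p).
  by rewrite perm_sym perm_catC /= perm_cons perm_catC perm_sym.
have uniq_p' : uniq (x :: p').
  rewrite (perm_uniq p'_perm1) cat_uniq uniq_q uniq_p andbT.
  by apply/hasPn => v vp; apply: contraL vp; exact: q_out.
have := p_max p'; rewrite /is_path path_p' uniq_p' => /(_ isT last_p').
rewrite (perm_size p'_perm) size_cat /=; lia.
Qed.

(** Otherwise a link through the component of [h] could replace the edge from [last x A] to [d]. *)
Lemma longest_path_no_insertion (G : sgraph) (x d h : G) (A D : seq G) :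
  longest_path x (A ++ d :: D) -> h \notin x :: A ++ d :: D ->
  last x A \in attachments (x :: A ++ d :: D) h ->
  d \notin attachments (x :: A ++ d :: D) h.
Proof.
move=> p_long hp uN; apply/negP => dN.
have [a [q [ua path_q qd uniq_q q_out]]] := attachments_link hp uN dN.
pose p' := A ++ (a :: q) ++ d :: D.
apply: (longest_path_no_detour (p' := p') p_long uniq_q) => //.
- by rewrite perm_catCA.
- by rewrite !last_cat.
have [/andP[path_p _] _] := p_long; move: path_p.
by rewrite !cat_path /= ?cat_path /= ua path_q qd => /and3P[-> _ ->].
Qed.

Lemma longest_path_no_crossing (G : sgraph) (x b d h : G) (A B D : seq G) :
  let p := A ++ (b :: B) ++ d :: D in
  longest_path x p -> h \notin x :: p ->
  last x A \in attachments (x :: p) h -> last b B \in attachments (x :: p) h ->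
  ~~ adj b d.
Proof.
move=> p p_long hp uN wN; apply/negP => bd.
have [a [q [ua path_q qw uniq_q q_out]]] := attachments_link hp uN wN.
pose p' := A ++ (a :: q) ++ rev (b :: B) ++ d :: D.
apply: (longest_path_no_detour (p' := p') p_long uniq_q) => //.
- by apply/permP => f; rewrite !count_cat count_rev; lia.
- by rewrite !last_cat.
by apply: path_detour => //; have [/andP[]] := p_long.
Qed.

Lemma successor_notin_attachments (G : sgraph) (x h u : G) (p : seq G) :
  longest_path x p -> h \notin x :: p -> u \in attachments (x :: p) h ->
  u != last x p ->
  successor x p u \in p /\ successor x p u \notin attachments (x :: p) h.
Proof.
move=> p_long hp uN u_last.
have up : u \in x :: p by move: uN; rewrite inE => /andP[].
have [A [d [D [p_eq Au]]]] := split_successor up u_last.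
have [/andP[_ uniq_p] _] := p_long.
rewrite -Au p_eq successorE -?p_eq // {1}p_eq mem_cat mem_head orbT; split=> //.
by move: p_long hp uN; rewrite p_eq -Au; exact: longest_path_no_insertion.
Qed.

Definition successors (G : sgraph) (x h : G) (p : seq G) : {set G} :=
  [set successor x p u | u in attachments (x :: p) h :\ last x p].

Lemma not_adj_attachments (G : sgraph) (c : seq G) (h v : G) :
  v \in c -> v \notin attachments c h -> ~~ adj v h.
Proof.
move=> vc; apply: contra => vh; rewrite inE vc.
by apply/existsP; exists h; rewrite connect0.
Qed.

(** A successor adjacent to [h] would itself be an attachment, which insertion rules out; two
    adjacent successors would give a crossing detour. *)
Lemma successors_independent (G : sgraph) (x h : G) (p : seq G) :
  longest_path x p -> h \notin x :: p -> independent (h |: successors x h p).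
Proof.
move=> p_long hp; have [/andP[_ uniq_p] _] := p_long.
have succ_h u : u \in attachments (x :: p) h :\ last x p ->
    ~~ adj (successor x p u) h.
  rewrite in_setD1 => /andP[u_last uN].
  have [vp vN] := successor_notin_attachments p_long hp uN u_last.
  by apply: (not_adj_attachments _ vN); rewrite inE vp orbT.
apply/forall_inP => v vS; apply/forall_inP => w wS.
case/setU1P: vS wS => [->|/imsetP[u uN ->]] /setU1P[->|/imsetP[u' u'N ->]].
- by rewrite adj_irr.
- by rewrite adj_sym succ_h.
- exact: succ_h.
have [->|uu'] := eqVneq u u'; first by rewrite adj_irr.
move: uN u'N; rewrite !in_setD1 => /andP[u_last uN] /andP[u'_last u'N].
have up : u \in x :: p by move: uN; rewrite inE => /andP[].
have u'p : u' \in x :: p by move: u'N; rewrite inE => /andP[].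
have [A [b [B [d [D [p_eq AB]]]]]] :=
  split_successor2 up u_last u'p u'_last uu'.
have succ_A : successor x p (last x A) = b.
  by rewrite p_eq successorE // -p_eq.
have succ_B : successor x p (last b B) = d.
  have -> : last b B = last x (A ++ b :: B) by rewrite last_cat.
  by rewrite p_eq catA successorE // -catA -p_eq.
have no_bd : last x A \in attachments (x :: p) h ->
    last b B \in attachments (x :: p) h -> ~~ adj b d.
  by rewrite p_eq in p_long hp *; exact: longest_path_no_crossing.
case: AB => -[Au Bu']; move: uN u'N; rewrite -Au -Bu' succ_A succ_B => uN u'N.
  exact: no_bd.
by rewrite adj_sym no_bd.
Qed.

(** The successor map is injective: path vertices are distinct, so the position of a successor fixes
    the prefix before it. The extra one is [h], which is off the path. *)
Lemma card_successors (G : sgraph) (x h : G) (p : seq G) :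
  longest_path x p -> h \notin x :: p ->
  #|h |: successors x h p| = #|attachments (x :: p) h :\ last x p|.+1.
Proof.
move=> p_long hp; have [/andP[_ uniq_p] _] := p_long.
have attach_split u : u \in attachments (x :: p) h :\ last x p ->
    exists A d D, p = A ++ d :: D /\ last x A = u.
  rewrite !inE => /andP[u_last /andP[up _]].
  by apply: split_successor => //; rewrite inE.
rewrite cardsU1 card_in_imset; last first.
  move=> u w /attach_split[A [d [D [p_eq <-]]]].
  case/attach_split=> B [b [E [p_eq' <-]]].
  rewrite {1}p_eq successorE -?p_eq // p_eq' successorE -?p_eq' // => db.
  rewrite {}db in p_eq *.
  suff AB : size A = size B.
    by move: p_eq; rewrite p_eq' => /eqP; rewrite eqseq_cat // => /andP[/eqP->].
  have b_index s t : p = s ++ b :: t -> index b p = size s.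
    move=> p_st; move: uniq_p; rewrite p_st /= cat_uniq /= negb_or.
    case/and3P=> _ _ /andP[/andP[bs _] _].
    by rewrite index_cat (negPf bs) /= eqxx addn0.
  by rewrite -(b_index _ _ p_eq) (b_index _ _ p_eq').
suff -> : h \notin successors x h p by [].
apply: contra hp => /imsetP[u /attach_split[A [d [D [p_eq <-]]]] ->].
by rewrite p_eq successorE -?p_eq // p_eq inE mem_cat mem_head !orbT.
Qed.

(** Provides the vertex to be separated from [h]: one of the first two vertices of the path, since
    consecutive vertices are not both attachments. *)
Lemma exists_nonattachment (G : sgraph) (x h : G) (p : seq G) :
  longest_path x p -> h \notin x :: p -> p != [::] ->
  exists2 z, z \in x :: p & z \notin attachments (x :: p) h.
Proof.
move=> p_long hp; case: p => // y p in p_long hp * => _.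
have [xN|] := boolP (x \in attachments (x :: y :: p) h); last first.
  by exists x; rewrite // mem_head.
exists y; first by rewrite !inE eqxx orbT.
exact: (longest_path_no_insertion (A := [::])).
Qed.

(** * The three forms of the Chvatal-Erdos theorem *)

Lemma chvatal_erdos_hamiltonian_connected (k : nat) (G : sgraph) :
  connected_graph G -> k_connected k G ->
  (forall S : {set G}, independent S -> #|S| < k) -> hamiltonian_connected G.
Proof.
move=> G_conn Gk ind_lt x y xy.
pose P p := is_path x p /\ last x p = y.
have [p0 [path_p0 last_p0 uniq_p0]] := connected_path x y G_conn.
have P0 : P p0 by rewrite /P /is_path path_p0.
have [|p [p_path p_last] p_max] := exists_longest P0.
  by move=> p [/andP[_ /andP[]]].
have p_long : longest_path x p.
  by split=> // q q_path q_last; apply: p_max; split; rewrite ?q_last.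
have /andP[path_p uniq_p] := p_path.
exists p; split=> // h; apply: contraT => hp.
have p_n0 : p != [::].
  by apply: contraNneq xy => p0E; rewrite -p_last p0E.
have [z zp zN] := exists_nonattachment p_long hp p_n0.
have := attachments_cut Gk hp zp zN.
have := ind_lt _ (successors_independent p_long hp).
rewrite card_successors // => N_lt.
(* At most one attachment, the last vertex, has no successor, and [h] makes up for it: the
   independent set is at least as large as the cut. *)
rewrite (cardsD1 (last x p)) leqNgt (leq_ltn_trans _ N_lt) //.
by rewrite -add1n leq_add2r leq_b1.
Qed.

Lemma chvatal_erdos_hamiltonian (k : nat) (G : sgraph) :
  connected_graph G -> 3 <= #|G| -> k_connected k G ->
  (forall S : {set G}, independent S -> #|S| <= k) -> hamiltonian G.
Proof.
move=> G_conn G_ge3 Gk ind_le.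
(* An edge counts here as a closed sequence of size two, so a starting point exists without finding
   a genuine cycle. The size condition follows at the end, when all of at least three vertices are
   covered. *)
pose P c := [/\ ucycle (@adj G) c & c != [::]].
have [c0 P0] : exists c, P c.
  have [x [y [_ _ xy]]] : exists x y : G, [/\ x \in G, y \in G & x != y].
    by apply/card_gt1P; apply: leq_trans G_ge3.
  have [[|z p] [path_p last_p _]] := connected_path x y G_conn.
    by move: xy; rewrite -last_p eqxx.
  have /andP[xz _] := path_p; exists [:: x; z]; split=> //.
  rewrite /ucycle /= xz adj_sym xz /= inE andbT.
  by apply: contraTneq xz => ->; rewrite adj_irr.
have [|c [/andP[cyc_c uniq_c] c_n0] c_max] := exists_longest P0.
  by move=> c [/andP[]].
(* A longer path with the same ends would be closed by the same edge into a longer cycle. *)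
have cyc_long x p : ucycle (@adj G) (x :: p) -> size (x :: p) = size c ->
    longest_path x p.
  rewrite /ucycle /= rcons_path => /andP[/andP[path_p xp] uniq_p] size_p.
  split=> [|q /andP[path_q uniq_q] q_last]; first by rewrite /is_path path_p.
  suff : size (x :: q) <= size c by rewrite -size_p.
  apply: c_max; split=> //.
  by rewrite /ucycle /= rcons_path path_q q_last xp.
have c_all h : h \in c.
  apply: contraT => hc.
  have [z zc zN] : exists2 z, z \in c & z \notin attachments c h.
    case: c => // x p in cyc_c uniq_c c_n0 c_max cyc_long hc *.
    have p_long : longest_path x p by apply: cyc_long; rewrite // /ucycle cyc_c.
    apply: exists_nonattachment => //; apply: contraTneq cyc_c => ->.
    by rewrite /= adj_irr.
  (* Rotating [z] to the front and then once more puts it last. As [z] is not an attachment, every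
     attachment has a successor, and [h] makes the independent set larger than the cut. *)
  have [i s c_rot] := rot_to zc.
  have rot_eq : rot 1 (rot i c) = rcons s z by rewrite c_rot rot1_cons.
  have cyc_s : ucycle (@adj G) (rcons s z).
    by rewrite -rot_eq /ucycle !rot_cycle !rot_uniq cyc_c.
  have size_s : size (rcons s z) = size c by rewrite -rot_eq !size_rot.
  have mem_s : rcons s z =i c by move=> v; rewrite -rot_eq !mem_rot.
  case s_eq : (rcons s z) => [|x p]; first by move: s_eq; case: (s).
  have last_p : last x p = z by rewrite -(last_cons z) -s_eq last_rcons.
  rewrite {}s_eq in cyc_s size_s mem_s.
  have p_long := cyc_long _ _ cyc_s size_s.
  have hp : h \notin x :: p by rewrite mem_s.
  have := ind_le _ (successors_independent p_long hp).
  rewrite card_successors // (eq_attachments h mem_s) last_p.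
  have := attachments_cut Gk hc zc zN.
  by rewrite (cardsD1 z) (negPf zN) add0n ltnNge => ->.
exists c; split=> //; first by rewrite /ucycle cyc_c.
apply: leq_trans G_ge3 _; rewrite -(card_uniqP uniq_c).
by apply/subset_leq_card/subsetP => v _; exact: c_all.
Qed.

Lemma chvatal_erdos_traceable (k : nat) (G : sgraph) :
  0 < #|G| -> k_connected k G ->
  (forall S : {set G}, independent S -> #|S| <= k.+1) -> traceable G.
Proof.
move=> /card_gt0P[x0 _] Gk ind_le.
pose P c := exists x p, c = x :: p /\ @is_path G x p.
have P0 : P [:: x0] by exists x0, [::].
have [|c [x [p [-> p_path]]] p_max] := exists_longest P0.
  by move=> c [x [p [-> /andP[]]]].
have long (y : G) (q : seq G) : is_path y q -> size q <= size p.
  move=> q_path; suff : size (y :: q) <= size (x :: p) by [].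
  by apply: p_max; exists y, q.
have p_long : longest_path x p by split=> // q q_path _; exact: long q_path.
have /andP[path_p uniq_p] := p_path.
exists x, (last x p), p; split=> // h; apply: contraT => hp.
set N := attachments (x :: p) h.
have N_E u : u \in N -> exists2 v, v \notin x :: p & adj u v.
  rewrite inE => /andP[_ /existsP[v /andP[hv uv]]].
  by exists v; first exact: connect_outside hv.
(* With free ends, an attachment at either end would let the path be extended by an outside
   vertex. *)
have last_N : last x p \notin N.
  apply/negP => /N_E[v vp uv]; have := long x (rcons p v).
  rewrite /is_path rcons_path path_p uv -rcons_cons rcons_uniq vp uniq_p.
  by rewrite size_rcons ltnn => /(_ isT).
have x_N : x \notin N.
  apply/negP => /N_E[v vp xv]; have := long v (x :: p).
  rewrite /is_path /= adj_sym xv path_p vp -/(uniq (x :: p)) uniq_p ltnn.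
  by move=> /(_ isT).
have x_succ u : u \in N -> u != last x p -> ~~ adj x (successor x p u).
  move=> uN u_last; apply/negP.
  have up : u \in x :: p by move: uN; rewrite inE => /andP[].
  have [A [d [D [p_eq Au]]]] := split_successor up u_last.
  rewrite -Au p_eq successorE -?p_eq // => xd.
  have [v vp uv] := N_E _ uN.
  (* Start at the outside neighbour [v] of [u], run back from [u] to [x], jump to [d] and continue:
     all of the path plus [v]. *)
  have /= := long v (rev (x :: A) ++ d :: D).
  rewrite /is_path cat_path /= p_eq !size_cat size_rev /=.
  have -> : last v (rev (x :: A)) = x by rewrite rev_cons last_rcons.
  have -> : path (@adj G) v (rev (x :: A)).
    have := rev_path (@adj G) x (rcons A v).
    rewrite last_rcons belast_rcons => ->.
    rewrite (eq_path (e' := @adj G)) => [|a b]; last exact: adj_sym.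
    rewrite rcons_path Au uv andbT.
    by move: path_p; rewrite p_eq cat_path => /andP[].
  rewrite xd; move: path_p; rewrite p_eq cat_path /= => /and3P[_ _ ->] /=.
  rewrite -[_ && _]/(uniq (v :: rev (x :: A) ++ d :: D)).
  have -> : uniq (v :: rev (x :: A) ++ d :: D).
    rewrite -(perm_uniq (s1 := v :: x :: p)); first by rewrite cons_uniq vp.
    by rewrite perm_cons p_eq -cat_cons perm_cat2r perm_sym perm_rev.
  by move=> /(_ isT); rewrite addSn ltnn.
pose S := x |: (h |: successors x h p).
have S_ind : independent S.
  have /forall_inP hS_ind := successors_independent p_long hp.
  have x_ind v : v \in h |: successors x h p -> ~~ adj x v.
    case/setU1P=> [->|/imsetP[u uN ->]].
      by apply: not_adj_attachments x_N; rewrite mem_head.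
    by move: uN; rewrite in_setD1 => /andP[u_last uN]; exact: x_succ.
  apply/forall_inP => v /setU1P[->|vS]; apply/forall_inP => w /setU1P[->|wS].
  - by rewrite adj_irr.
  - exact: x_ind.
  - by rewrite adj_sym x_ind.
  - by have /forall_inP := hS_ind _ vS; apply.
have x_S : x \notin h |: successors x h p.
  rewrite in_setU1 negb_or; apply/andP; split.
    by apply: contraNneq hp => <-; rewrite mem_head.
  apply/negP => /imsetP[u]; rewrite in_setD1 => /andP[u_last uN] x_eq.
  have [] := successor_notin_attachments p_long hp uN u_last.
  by move: uniq_p; rewrite -x_eq /= => /andP[/negPf->].
(* All attachments have successors, so [S] has two elements more than [N], whereas [N] has at least
   [k]. *)
have := ind_le _ S_ind; rewrite cardsU1 x_S card_successors // -/N.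
have := attachments_cut Gk hp (mem_last x p) last_N; rewrite -/N.
by rewrite (cardsD1 (last x p)) (negPf last_N); lia.
Qed.

Local Open Scope ring_scope.

(** * The Rayleigh quotient bound *)

Lemma symmetric_mx_quadratic_le (R : rcfType) (n : nat) (A : 'M[R]_n) (mu : R)
    (x : 'rV[R]_n) :
  A^T = A -> (forall b, eigenvalue A b -> b <= mu) ->
  (x *m A *m x^T) 0 0 <= mu * (x *m x^T) 0 0.
Proof.
move=> A_sym A_le.
(* The spectral theorem is applied to the Hermitian matrix [B] over the complex numbers. *)
pose f := real_complex R; pose B := map_mx f A; pose xc := map_mx f x.
have B_herm : B \is hermsymmx.
  apply/is_hermitianmxP; rewrite expr0 scale1r.
  by apply/matrixP=> i j; rewrite !mxE [RHS]conjc_real -[in LHS]A_sym mxE.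
have /hermitian_normalmx /orthomx_spectralP B_eq := B_herm.
have D_real := hermitian_spectral_diag_real B_herm.
have P_unit := spectral_unit B.
have P_unitary := spectral_unitarymx B.
set P := spectralmx B in B_eq D_real P_unit P_unitary.
set D := spectral_diag B in B_eq D_real.
(* Row [j] of [P] is an eigenvector of [B]; its eigenvalue is real and hence also one of [A]. *)
have D_le j : D 0 j <= f mu.
  have /complex_realP[d Dd] := mxOverP D_real 0 j.
  rewrite Dd lecR; apply: A_le; rewrite -(eigenvalue_map f).
  apply/eigenvalueP; exists (row j P).
    rewrite [map_mx _ _]B_eq mulmxA mulmxA -row_mul mulmxV // -row_mul mul1mx.
    by rewrite row_diag_mx -scalemxAl -rowE Dd.
  rewrite rowE -(mul0mx _ P) (can_eq (mulmxK P_unit)).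
  by apply/eqP => /matrixP/(_ 0 j)/eqP; rewrite !mxE !eqxx oner_eq0.
suff: f ((x *m A *m x^T) 0 0) <= f mu * f ((x *m x^T) 0 0).
  by rewrite -rmorphM lecR.
(* The coordinates of [xc] in the eigenbasis; both quadratic forms become weighted sums of their
   squared moduli. *)
have [y yE] : exists y, y = xc *m invmx P by eexists.
have ytE : (map_mx Num.conj y)^T = P *m xc^T.
  rewrite yE invmx_unitary // map_mxM trmx_mul; congr (_ *m _).
    by apply/matrixP=> i j; rewrite !mxE [LHS]conjCK.
  by apply/matrixP=> i j; rewrite !mxE [LHS]conjc_real.
have -> : f ((x *m A *m x^T) 0 0) = \sum_j D 0 j * (y 0 j * (y 0 j)^*).
  have -> : f ((x *m A *m x^T) 0 0) = (map_mx f (x *m A *m x^T)) 0 0.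
    by rewrite [RHS]mxE.
  rewrite !map_mxM -map_trmx -/xc -/B B_eq !mulmxA -yE -mulmxA -ytE.
  rewrite mxE; apply: eq_bigr => j _.
  by rewrite mul_mx_diag !mxE [y 0 j * _]mulrC -mulrA.
have -> : f ((x *m x^T) 0 0) = \sum_j y 0 j * (y 0 j)^*.
  have -> : f ((x *m x^T) 0 0) = (map_mx f (x *m x^T)) 0 0 by rewrite [RHS]mxE.
  rewrite map_mxM -map_trmx -/xc -{1}[xc](mulmxKV P_unit) -yE -mulmxA -ytE.
  by rewrite mxE; apply: eq_bigr => j _; rewrite !mxE.
by rewrite mulr_sumr ler_sum // => j _; rewrite ler_wpM2r ?mul_conjC_ge0.
Qed.

(** The Rayleigh bound carried from matrix indices to vertices along [enum_val]; the left side is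
    the quadratic form of the Laplacian at [f]. *)
Lemma laplacian_quadratic_le (R : realType) (G : sgraph) (mu : R) (f : G -> R) :
  laplacian_spectral_radius G mu ->
  \sum_u f u * \sum_v (adj u v)%:R * (f u - f v) <= mu * \sum_u f u ^+ 2.
Proof.
move=> [_ mu_max].
pose x : 'rV[R]_#|G| := \row_i f (enum_val i).
have L_sym : (laplacian_mx R G)^T = laplacian_mx R G.
  apply/matrixP=> i j; rewrite !mxE adj_sym eq_sym.
  by case: eqP => [->|].
have /= := symmetric_mx_quadratic_le x L_sym mu_max.
have -> : (x *m x^T) 0 0 = \sum_u f u ^+ 2.
  rewrite mxE (reindex _ (onW_bij _ (@enum_val_bij G))) /=.
  by apply: eq_bigr => i _; rewrite !mxE.
suff -> : (x *m laplacian_mx R G *m x^T) 0 0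
    = \sum_u f u * \sum_v (adj u v)%:R * (f u - f v) by [].
rewrite -mulmxA mxE (reindex _ (onW_bij _ (@enum_val_bij G))) /=.
apply: eq_bigr => i _; rewrite !mxE; congr (_ * _).
rewrite (reindex _ (onW_bij _ (@enum_val_bij G))) /=.
under eq_bigr do rewrite !mxE mulrBl.
under [in RHS]eq_bigr do rewrite mulrBr.
rewrite !sumrB; congr (_ - _).
rewrite (bigD1 i) //= eqxx mulr1n big1 ?addr0; last first.
  by move=> j /negPf ji; rewrite eq_sym ji mulr0n mul0r.
rewrite -mulr_suml; congr (_ * _).
rewrite /deg -sum1_card natr_sum big_mkcond /=.
rewrite (reindex _ (onW_bij _ (@enum_val_bij G))) /=.
by apply: eq_bigr => j _; rewrite inE; case: adj.
Qed.

(** * Independent sets and the Laplacian spectral radius *)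

Lemma min_degree_le (G : sgraph) (x : G) : (min_degree G <= deg x)%N.
Proof.
exact: (@bigmin_inf _ _ _ #|G| x predT _ (@deg G)).
Qed.

(** All edges at a vertex of [S] leave [S], so the quadratic form at the test vector is at least
    $n^2 |S| \delta$, while its squared norm is $n|S|(n-|S|)$; the positive factor $n|S|$
    cancels. *)
Lemma independent_card_bound (R : realType) (G : sgraph) (mu : R)
    (S : {set G}) :
  laplacian_spectral_radius G mu -> independent S -> S != set0 ->
  #|G|%:R * (min_degree G)%:R <= mu * (#|G|%:R - #|S|%:R).
Proof.
move=> mu_def /forall_inP S_ind S_n0.
set n : R := #|G|%:R; set s : R := #|S|%:R.
pose b (u : G) : R := (u \in S)%:R.
have /= := laplacian_quadratic_le (fun u => n * b u - s) mu_def.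
have sum_b : \sum_u b u = s.
  rewrite /s -sum1_card natr_sum [RHS]big_mkcond /=.
  by apply: eq_bigr => u _; rewrite /b; case: (u \in S).
have s_gt0 : 0 < s by rewrite ltr0n card_gt0.
have n_gt0 : 0 < n by rewrite (lt_le_trans s_gt0) // ler_nat max_card.
have -> : \sum_u (n * b u - s) ^+ 2 = n * s * (n - s).
  have -> : \sum_u (n * b u - s) ^+ 2
      = \sum_u ((n ^+ 2 - n * s *+ 2) * b u + s ^+ 2).
    apply: eq_bigr => u _; rewrite /b; case: (u \in S) => /=; lra.
  rewrite big_split /= -mulr_sumr sum_b sumr_const -[_ *+ #|_|]mulr_natr -/n.
  lra.
set Q := \sum_u _ => Q_le.
suff Q_ge : n ^+ 2 * (s * (min_degree G)%:R) <= Q.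
  have := le_trans Q_ge Q_le.
  have -> : n ^+ 2 * (s * (min_degree G)%:R)
      = (n * s) * (n * (min_degree G)%:R) by lra.
  have -> : mu * (n * s * (n - s)) = (n * s) * (mu * (n - s)) by lra.
  by rewrite ler_pM2l ?mulr_gt0.
(* The Laplacian applied to the indicator [b]; the constant shift by [s] vanishes in the
   differences. *)
pose g u := \sum_v (adj u v)%:R * (b u - b v).
have -> : Q = n ^+ 2 * \sum_u b u * g u - n * s * \sum_u g u.
  rewrite !mulr_sumr -sumrB; apply: eq_bigr => u _.
  have -> : \sum_v (adj u v)%:R * (n * b u - s - (n * b v - s)) = n * g u.
    by rewrite mulr_sumr; apply: eq_bigr => v _; lra.
  lra.
(* Exchanging the two summations changes the sign. *)
have -> : \sum_u g u = 0.
  have : \sum_u g u = - \sum_u g u.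
    rewrite {1}/g [LHS]exchange_big -sumrN; apply: eq_bigr => v _.
    by rewrite -sumrN; apply: eq_bigr => u _; rewrite adj_sym; ring.
  lra.
rewrite mulr0 subr0 ler_pM2l ?exprn_gt0 // -sum_b mulr_suml.
apply: ler_sum => u _; rewrite {1 2}/b.
have [uS|_] := boolP (u \in S); last by rewrite !mul0r.
rewrite !mul1r (le_trans (y := (deg u)%:R)) ?ler_nat ?min_degree_le //.
rewrite /deg -sum1_card natr_sum big_mkcond /=.
apply: ler_sum => v _; rewrite inE /b uS.
have /forall_inP Su := S_ind _ uS.
case: ifP => uv; last by rewrite mul0r.
by have [/Su|_] := boolP (v \in S); rewrite ?uv // mul1r subr0.
Qed.
Lemma independent_card_lt (R : realType) (G : sgraph) (mu D : R) (S : {set G}) :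
  (1 < #|G|)%N -> laplacian_spectral_radius G mu ->
  mu < #|G|%:R * (min_degree G)%:R / D -> independent S -> S != set0 ->
  #|S|%:R < #|G|%:R - D.
Proof.
move=> G_gt1 mu_def mu_lt S_ind S_n0.
have S_le := independent_card_bound mu_def S_ind S_n0.
set m : R := #|G|%:R * _ in mu_lt S_le.
have m_ge0 : 0 <= m by rewrite mulr_ge0.
(* A singleton is used because $n-1$ is positive, whereas $n-|S|$ is not yet known to be. *)
have mu_ge0 : 0 <= mu.
  have /set0Pn[x _] := S_n0.
  have x_ind : independent [set x].
    apply/forall_inP => u /set1P->; apply/forall_inP => v /set1P->.
    by rewrite adj_irr.
  have x_n0 : [set x] != set0 by rewrite -cards_eq0 cards1.
  have := le_trans m_ge0 (independent_card_bound mu_def x_ind x_n0).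
  by rewrite cards1 pmulr_lge0 // subr_gt0 ltr1n.
(* For [D <= 0] the quotient would be at most zero, also at [D = 0], where the inverse is zero by
   convention; but it exceeds [mu >= 0]. *)
have D_gt0 : 0 < D.
  rewrite ltNge; apply/negP => D_le0.
  have : m / D <= 0 by rewrite mulr_ge0_le0 // invr_le0.
  by rewrite leNgt (le_lt_trans mu_ge0 mu_lt).
rewrite ltrBrDr -ltrBrDl ltNge; apply/negP => D_ge.
have := ler_wpM2l mu_ge0 D_ge.
by rewrite leNgt (lt_le_trans _ S_le) // -ltr_pdivlMr.
Qed.

Theorem theorem1p4 (R : realType) (k n : nat) (G : sgraph) (s : int) (mu1 : R)
    (k_gt0 : (0 < k)%N)
    (G_order : #|G| = n) (n_ge3 : (3 <= n)%N)
    (G_connected : connected_graph G)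
    (G_kconnected : k_connected k G)
    (s_range : s \in [:: 1; 0; -1])
    (mu1_def : laplacian_spectral_radius G mu1)
    (mu1_bound :
      mu1 < n%:R * (min_degree G)%:R / (n%:R - k%:R + s%:~R - 1)) :
  [/\ s = 1 -> hamiltonian_connected G,
      s = 0 -> hamiltonian G
    & s = -1 -> traceable G].
Proof.
subst n.
(* With $D = n-k+s-1$ the bound $n-D$ is $k-s+1$, that is $k$, $k+1$ and $k+2$ for $s = 1, 0, -1$.
   The empty set stands apart because the test vector needs a nonempty set. *)
have card_lt (S : {set G}) : independent S ->
    S = set0 \/ (#|S|%:R : R) < k%:R - s%:~R + 1.
  move=> S_ind; have [->|S_n0] := eqVneq S set0; [by left|right].
  have := independent_card_lt (ltnW n_ge3) mu1_def mu1_bound S_ind S_n0.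
  lra.
split=> s_eq; rewrite {}s_eq in card_lt.
- apply: chvatal_erdos_hamiltonian_connected G_connected G_kconnected _.
  by move=> S /card_lt[->|]; rewrite ?cards0 // subrK ltr_nat.
- apply: chvatal_erdos_hamiltonian G_connected n_ge3 G_kconnected _.
  move=> S /card_lt[->|]; first by rewrite cards0.
  by rewrite subr0 natr1 ltr_nat ltnS.
apply: chvatal_erdos_traceable (ltnW (ltnW n_ge3)) G_kconnected _.
move=> S /card_lt[->|]; first by rewrite cards0.
by rewrite mulrNz mulr1z opprK !natr1 ltr_nat ltnS.
Qed.
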